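(* Let $\hat X\in E$, $c\ge 0$, and let the desired potential be $\mathbb V_{\mathrm{des}}(X)=\frac c2\|X-\hat X\|^2$. Fix $\Delta t>0$ and a constant gradient step size $\rho^l=\rho>0$ for all $l\in\mathbb N_0$, and consider the instantaneous rolling horizon control algorithm for the semi-explicit Euler scheme (see context) with initial data $X^0=X_0$, $V^0=V_0\in E$. Put $$c_1:=\rho(\Delta t)^2\bigl(1+c(\Delta t)^2\bigr),\quad c_2:=\rho(\Delta t)^3\bigl(1+c(\Delta t)^2\bigr),\quad c_3:=c\rho(\Delta t)^3,\quad T:=I-c_2\mathbb B\mathbb B^*.$$ (i) Let $u_0^l=0$ for all $l\in\mathbb N_0$. Then the feedback computed by the algorithm is $u^l=\alpha(X^l,V^l)$ with $$\alpha(X,V)=-c_1\mathbb B^*V+c_2\mathbb B^*\bigl(\Psi(X)V+\nabla\mathbb V(X)\bigr)-F(X),\qquad F(X)=c_3\mathbb B^*(X-\hat X),$$ and therefore the algorithm computes the semi-explicit Euler iterates with step size $\Delta t$ and initial condition $X(0)=X_0$, $V(0)=V_0$ of $$\tfrac{d}{dt}X_t=V_t,\qquad \tfrac{d}{dt}V_t=-c_1\mathbb B\mathbb B^*V_t-(I-c_2\mathbb B\mathbb B^* )\bigl(\Psi(X_t)V_t+\nabla\mathbb V(X_t)\bigr)-c_3\mathbb B\mathbb B^*(X_t-\hat X).$$ In particular, if $c_2\|\mathbb B\mathbb B^*\|<1$, then with $\hat{\mathbb V}(X)=\frac{c_3}{2}\|\mathbb B^*T^{-1/2}(X-\hat X)\|^2$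 one has $\mathbb B F(X)=T\nabla\hat{\mathbb V}(X)$ for all $X\in E$, and this continuous time system admits the port-Hamiltonian formulation (PH) given in the context. (ii) Suppose that $\nabla\mathbb V(\hat X)\in\operatorname{ran}(\mathbb B)$, i.e. $\mathbb B\hat\alpha=\nabla\mathbb V(\hat X)$ for some $\hat\alpha\in U$, and let $u_0^l=\hat\alpha$ for all $l\in\mathbb N_0$. Then the feedback computed by the algorithm is $u^l=\alpha(X^l,V^l)$ with $$\alpha(X,V)=-c_1\mathbb B^*V+c_2\mathbb B^*\bigl(\Psi(X)V+\nabla\mathbb V(X)\bigr)-F(X),\qquad F(X)=c_3\mathbb B^*(X-\hat X)-\hat\alpha+c_2\mathbb B^*\nabla\mathbb V(\hat X),$$ and therefore the algorithm computes the semi-explicit Euler iterates with step size $\Delta t$ and initial condition $X(0)=X_0$, $V(0)=V_0$ of $$\tfrac{d}{dt}X_t=V_t,\qquad \tfrac{d}{dt}V_t=-c_1\mathbb B\mathbb B^*V_t-(I-c_2\mathbb B\mathbb B^* )\bigl(\Psi(X_t)V_t+\nabla\mathbb V(X_t)-\nabla\mathbb V(\hat X)\bigr)-c_3\mathbb B\mathbb B^*(X_t-\hat X).$$ In particular, if $c_2\|\mathbb B\mathbb B^*\|<1$, then with $\hat{\mathbb V}(X)=\frac{c_3}{2}\|\mathbb B^*T^{-1/2}(X-\hat X)\|^2-\langle\nabla\mathbb V(\hat X),X-\hat X\rangle$ one has $\mathbb B F(X)=T\nabla\hat{\mathbb V}(X)$ for all $X\in E$, and this continuous time system admits the port-Hamiltonian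 formulation (PH) given in the context.
   Context: Standing assumptions. $E,U$ are real Hilbert spaces with norms $\|\cdot\|$ and inner products $\langle\cdot,\cdot\rangle$; gradients are Riesz gradients. $\mathbb V\in C^1(E;\mathbb R)$ is bounded from below by $\underline{\mathcal V}\in\mathbb R$ and there is $C>0$ with $\|\nabla\mathbb V(X)\|^2\le C(1+\mathbb V(X)-\underline{\mathcal V})$ for all $X\in E$. $\Psi:E\to\mathscr L(E)$ is bounded and $\Psi(X)$ is self-adjoint and positive semidefinite for every $X\in E$. $\mathbb B\in\mathscr L(U;E)$ has closed range. The open loop system is $\frac{d}{dt}X_t=V_t$, $\frac{d}{dt}V_t=-\Psi(X_t)V_t-\nabla\mathbb V(X_t)+\mathbb Bu(t)$. Algorithm (instantaneous rolling horizon control, semi-explicit Euler). For $(X^l,V^l)\in E\times E$ and $u\in U$ let $\Phi(\Delta t,X^l,V^l,u)=(X^{l+1},V^{l+1})$ with $V^{l+1}=V^l-\Delta t(\Psi(X^l)V^l+\nabla\mathbb V(X^l))+\Delta t\,\mathbb Bu$, $X^{l+1}=X^l+\Delta t\,V^{l+1}$. Let $H_{\mathrm{des}}(X,V)=\frac12\|V\|^2+\mathbb V_{\mathrm{des}}(X)$ and $f_d^l(u)=\Delta t\,H_{\mathrm{des}}(\Phi(\Delta t,X^l,V^l,u))$. Given the initial guess $u_0^l\in U$, the algorithm performs one gradient step $u^l=u_0^l-\rho^l\nabla f_d^l(u_0^l)$, sets $(X^{l+1},V^{l+1})=\Phi(\Delta t,X^l,V^l,u^l)$, and proceeds to $l+1$.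 The semi-explicit Euler iterates with step size $\Delta t$ of a system $\frac{d}{dt}X_t=V_t$, $\frac{d}{dt}V_t=G(X_t,V_t)$ are $V^{l+1}=V^l+\Delta t\,G(X^l,V^l)$, $X^{l+1}=X^l+\Delta t\,V^{l+1}$. Port-Hamiltonian formulation (PH). With $H_{\mathrm{cl}}(X,V)=\frac12\langle V,T^{-1}V\rangle+\mathbb V(X)+\hat{\mathbb V}(X)$ (where $c_2\|\mathbb B\mathbb B^*\|<1$ makes $T$ self-adjoint, positive definite and boundedly invertible), functions $X,V\in C^1([0,\infty);E)$ solve the continuous time system if and only if $$\frac{d}{dt}\begin{pmatrix}X_t\\ V_t\end{pmatrix}=\left(\begin{pmatrix}0&T\\-T&0\end{pmatrix}-\begin{pmatrix}0&0\\0&T\Psi(X_t)T+c_1T^{1/2}\mathbb B\mathbb B^*T^{1/2}\end{pmatrix}\right)\nabla H_{\mathrm{cl}}(X_t,V_t),$$ with the same initial conditions. *)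

(* Defs.v *)
From HB Require Import structures.
From mathcomp Require Import all_boot all_order all_algebra.
From mathcomp Require Import all_classical all_reals all_analysis.

Set Implicit Arguments.
Unset Strict Implicit.
Unset Printing Implicit Defensive.

Import Order.TTheory GRing.Theory Num.Theory.
Import numFieldNormedType.Exports.

Local Open Scope classical_set_scope.
Local Open Scope ring_scope.

HB.mixin Record CompleteNormedModule_isHilbert (R : realType) E
    of CompleteNormedModule R E := {
  inner : {dot E for (idfun : R -> R)} ;
  inner_norm : forall x : E, inner x x = `|x| ^+ 2
}.

#[short(type="hilbertType")]
HB.structure Definition Hilbert (R : realType) :=
  {E of CompleteNormedModule_isHilbert R E & CompleteNormedModule R E}.

Section Gradient.
Context {R : realType}.

(* Riesz gradient with respect to the inner product [ip]; the inner product is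
   a parameter because the library norm on a product [E * E] is the maximum of
   the norms, which is equivalent, but not equal, to the Hilbert norm. *)
Definition gradient {W : normedModType R} (ip : W -> W -> R)
    (f : W -> R) (x : W) : W :=
  get [set g : W | forall h, 'd f x h = ip g h].

Definition grad {E : hilbertType R} (f : E -> R) (x : E) : E :=
  gradient (@inner R E) f x.

Definition prod_inner {E F : hilbertType R} (z w : E * F) : R :=
  inner z.1 w.1 + inner z.2 w.2.

Definition prod_grad {E F : hilbertType R} (f : E * F -> R) (z : E * F) :
  E * F := gradient (@prod_inner E F) f z.

End Gradient.

Section Operators.
Context {R : realType}.

Definition opnorm {V W : normedModType R} (A : V -> W) : R :=
  sup [set `|A x| | x in [set x : V | `|x| <= 1]].

(* Continuity of the Frechet derivative is in the dual norm. *)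
Definition C1_functional {W : normedModType R} (f : W -> R) : Prop :=
  (forall x, differentiable f x) /\
  (forall x, opnorm (fun h => 'd f y h - 'd f x h) @[y --> x] --> (0 : R)).

Definition adjoint {E F : hilbertType R} (A : E -> F) : {linear F -> E} :=
  get [set A' : {linear F -> E} |
    continuous A' /\ forall x y, inner (A x) y = inner x (A' y)].

Context {E : hilbertType R}.

Definition selfadjoint (A : E -> E) : Prop :=
  forall x y, inner (A x) y = inner x (A y).

Definition possemidef (A : E -> E) : Prop := forall x, 0 <= inner (A x) x.

Definition posdef (A : E -> E) : Prop := forall x, x != 0 -> 0 < inner (A x) x.

Definition opinv (A : E -> E) : E -> E := pinv [set: E] A.

Definition boundedly_invertible (A : E -> E) : Prop :=
  bijective A /\ continuous (opinv A).

Definition is_opsqrt (A : E -> E) (S : {linear E -> E}) : Prop :=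
  [/\ continuous S, selfadjoint S, possemidef S & forall x, S (S x) = A x].

Definition opsqrt (A : E -> E) : {linear E -> E} := get (is_opsqrt A).

Definition block_op (A11 A12 A21 A22 : E -> E) (z : E * E) : E * E :=
  (A11 z.1 + A12 z.2, A21 z.1 + A22 z.2).

End Operators.

Section Trajectories.
Context {R : realType}.

(* Derivative on [0, +oo[, one-sided at 0. *)
Definition has_deriv {W : normedModType R} (x : R -> W) (t : R) (v : W) : Prop :=
  (s - t)^-1 *: (x s - x t) @[s --> within `[0, +oo[ t^'] --> v.

Definition C1_halfline {W : normedModType R} (x : R -> W) : Prop :=
  exists2 x' : R -> W, {within `[0, +oo[, continuous x'} &
    forall t, 0 <= t -> has_deriv x t (x' t).

Context {E : hilbertType R}.

Definition solves_2nd_order (G : E -> E -> E) (X V : R -> E) : Prop :=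
  forall t, 0 <= t -> has_deriv X t (V t) /\ has_deriv V t (G (X t) (V t)).

Fixpoint semi_explicit_euler (dt : R) (G : E -> E -> E) (X0 V0 : E) (l : nat) :
    E * E :=
  if l is k.+1 then
    let: (X, V) := semi_explicit_euler dt G X0 V0 k in
    let V' := V + dt *: G X V in
    (X + dt *: V', V')
  else (X0, V0).

End Trajectories.

Section RollingHorizon.
Context {R : realType} {E U : hilbertType R}.
Variables (VV : E -> R) (Psi : E -> {linear E -> E}) (B : {linear U -> E}).

Definition Phi (dt : R) (X V : E) (u : U) : E * E :=
  let V' := V - dt *: (Psi X V + grad VV X) + dt *: B u in
  (X + dt *: V', V').

Variables (Vdes : E -> R) (dt : R) (rho : nat -> R) (u0 : nat -> U).

Definition Hdes (z : E * E) : R := 2^-1 * `|z.2| ^+ 2 + Vdes z.1.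

Definition fd (z : E * E) (u : U) : R := dt * Hdes (Phi dt z.1 z.2 u).

Definition irh_step (l : nat) (z : E * E) : U :=
  u0 l - rho l *: grad (fd z) (u0 l).

Fixpoint irh_state (X0 V0 : E) (l : nat) : E * E :=
  if l is k.+1 then
    let z := irh_state X0 V0 k in Phi dt z.1 z.2 (irh_step k z)
  else (X0, V0).

Definition irh_control (X0 V0 : E) (l : nat) : U :=
  irh_step l (irh_state X0 V0 l).

End RollingHorizon.

Section PortHamiltonian.
Context {R : realType} {E U : hilbertType R}.
Variables (VV : E -> R) (Psi : E -> {linear E -> E}) (B : {linear U -> E}).
Variables (c1 : R) (T : E -> E) (Vhat : E -> R).

Definition Hcl (z : E * E) : R :=
  2^-1 * inner z.2 (opinv T z.2) + VV z.1 + Vhat z.1.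

Definition PH_J : E * E -> E * E := block_op (fun=> 0) T (fun x => - T x) (fun=> 0).

Definition PH_R (X : E) : E * E -> E * E :=
  block_op (fun=> 0) (fun=> 0) (fun=> 0)
    (fun x => T (Psi X (T x)) + c1 *: opsqrt T (B (adjoint B (opsqrt T x)))).

Definition solves_PH (X V : R -> E) : Prop :=
  forall t, 0 <= t ->
    let z := prod_grad Hcl (X t, V t) in
    has_deriv (fun s => (X s, V s)) t (PH_J z - PH_R (X t) z).

(* The first five conjuncts say that [T^-1], [T^(1/2)] and the gradient of
   [Hcl], which are total functions here, are the genuine ones. *)
Definition admits_PH (G : E -> E -> E) : Prop :=
  [/\ selfadjoint T, posdef T, boundedly_invertible T,
      is_opsqrt T (opsqrt T) & forall z, differentiable Hcl z] /\
  forall (X0 V0 : E) (X V : R -> E), C1_halfline X -> C1_halfline V ->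
    [/\ X 0 = X0, V 0 = V0 & solves_2nd_order G X V] <->
    [/\ X 0 = X0, V 0 = V0 & solves_PH X V].

End PortHamiltonian.

(* Main.v *)
From HB Require Import structures.
Require Import Defs.
From mathcomp Require Import all_boot all_order all_algebra.
From mathcomp Require Import all_classical all_reals all_analysis.
From mathcomp Require Import ring lra.

Import Order.TTheory GRing.Theory Num.Theory.
Import numFieldNormedType.Exports.

Local Open Scope classical_set_scope.
Local Open Scope ring_scope.

(* The cost of one time step is quadratic in the control, so its gradient, and
   hence the feedback, is explicit; inserting the feedback into the scheme gives
   the closed loop. If c2 ||B B*|| < 1, then T = I - c2 B B* is coercive and has
   a bounded positive square root S with S^2 = T, which commutes with B B*.
   Hence the shaped potential c3/2 |B* S^-1 (X - Xhat)|^2 has gradient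
   c3 S^-1 B B* S^-1 (X - Xhat), which T maps to c3 B B* (X - Xhat), and
   S B B* S applied to the momentum gradient T^-1 V gives B B* V. *)

(** * Algebra of the real inner product and the Cauchy-Schwarz inequality *)

Section InnerProduct.
Context {R : realType} {E : hilbertType R}.
Implicit Types (x y z : E) (a : R).

Lemma innerC x y : inner x y = inner y x.
Proof. by rewrite hermitian_subproof expr0 mul1r. Qed.

Lemma innerDl x y z : inner (x + y) z = inner x z + inner y z.
Proof. by rewrite linearDl. Qed.

Lemma innerZl a x y : inner (a *: x) y = a * inner x y.
Proof. by rewrite linearZl. Qed.

Lemma innerDr x y z : inner x (y + z) = inner x y + inner x z.
Proof. by rewrite innerC innerDl !(innerC x). Qed.

Lemma innerZr a x y : inner x (a *: y) = a * inner x y.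
Proof. by rewrite innerC innerZl innerC. Qed.

Lemma innerNl x y : inner (- x) y = - inner x y.
Proof. by rewrite -scaleN1r innerZl mulN1r. Qed.

Lemma innerNr x y : inner x (- y) = - inner x y.
Proof. by rewrite innerC innerNl innerC. Qed.

Lemma inner0l x : inner 0 x = 0.
Proof. by rewrite -(scale0r 0) innerZl mul0r. Qed.

Lemma inner0r x : inner x 0 = 0.
Proof. by rewrite innerC inner0l. Qed.

Definition innerE := (innerDl, innerDr, innerZl, innerZr, innerNl, innerNr).

Lemma innerI x y : (forall z, inner x z = inner y z) -> x = y.
Proof.
move=> xy; apply/eqP; rewrite -subr_eq0 -normr_eq0 -sqrf_eq0 -inner_norm.
by rewrite innerDl innerNl xy subrr.
Qed.

Lemma normD2 x y : `|x + y| ^+ 2 = `|x| ^+ 2 + 2 * inner x y + `|y| ^+ 2.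
Proof. by rewrite -!inner_norm !innerE (innerC y x); ring. Qed.

(** Cauchy-Schwarz: expand the squared norm of |y| x - |x| y and divide by |x| |y|, which is why
    zero vectors are treated first. *)
Lemma inner_le x y : inner x y <= `|x| * `|y|.
Proof.
have [->|x0] := eqVneq x 0; first by rewrite inner0l normr0 mul0r.
have [->|y0] := eqVneq y 0; first by rewrite inner0r normr0 mulr0.
have x_gt0 : 0 < `|x| by rewrite normr_gt0.
have y_gt0 : 0 < `|y| by rewrite normr_gt0.
have : 0 <= `| (`|y| *: x) - `|x| *: y | ^+ 2 by rewrite sqr_ge0.
rewrite normD2 normrN !normrZ !normr_id innerNr innerZl innerZr => h.
rewrite -subr_ge0 -(pmulr_rge0 _ (mulr_gt0 x_gt0 y_gt0)).
by rewrite -(pmulr_rge0 _ (ltr0Sn R 1)); nra.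
Qed.

Lemma normr_inner_le x y : `|inner x y| <= `|x| * `|y|.
Proof.
rewrite ler_norml inner_le andbT lerNl -innerNl.
by rewrite (le_trans (inner_le _ _)) // normrN.
Qed.

End InnerProduct.

(** * Bounded linear operators and the operator norm *)

Section Bounded.
Context {R : realType}.

(** A predicate on bare functions, because [T], its inverse and limits of operators do not come as
    bundled linear maps. *)
Definition bounded_op {V W : normedModType R} (A : V -> W) : Prop :=
  linear A /\ exists2 M, 0 <= M & forall x, `|A x| <= M * `|x|.

Section Theory.
Context {V W : normedModType R} {A : V -> W} (Ab : bounded_op A).

Lemma bounded_opD x y : A (x + y) = A x + A y.
Proof. by have [/(_ 1 x y)] := Ab; rewrite !scale1r. Qed.

Lemma bounded_op0 : A 0 = 0.
Proof. by apply: (addrI (A 0)); rewrite -bounded_opD !addr0. Qed.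

Lemma bounded_opZ a x : A (a *: x) = a *: A x.
Proof. by have [/(_ a x 0)] := Ab; rewrite bounded_op0 !addr0. Qed.

Lemma bounded_opN x : A (- x) = - A x.
Proof. by rewrite -scaleN1r bounded_opZ scaleN1r. Qed.

Lemma bounded_opB x y : A (x - y) = A x - A y.
Proof. by rewrite bounded_opD bounded_opN. Qed.

Lemma bounded_op_linear : exists2 A' : {linear V -> W}, A = A' & continuous A'.
Proof.
have [Al [M M0 AM]] := Ab.
pose A' : {linear V -> W} := HB.pack A (GRing.isLinear.Build _ _ _ _ A Al).
exists A' => //; apply/linear_bounded_continuous/linear_boundedP.
exists M; split=> [|r Mr x]; first exact: num_real.
by rewrite (le_trans (AM x)) // ler_wpM2r // ltW.
Qed.

Lemma bounded_op_continuous : continuous A.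
Proof. by have [A' ->] := bounded_op_linear. Qed.

End Theory.

Lemma continuous_bounded_op {V W : normedModType R} {A : {linear V -> W}} :
  continuous A -> bounded_op A.
Proof.
move=> Ac; split; first exact: linearP.
have /linear_boundedP/pinfty_ex_gt0[M M0 AM] :
  bounded_near A (nbhs 0) by apply/linear_bounded_continuous.
by exists M => //; exact: ltW.
Qed.

Lemma bounded_op_comp {V W Z : normedModType R} {A : W -> Z} {B : V -> W} :
  bounded_op A -> bounded_op B -> bounded_op (A \o B).
Proof.
move=> Ab Bb; split=> [a x y /=|].
  by rewrite bounded_opD // bounded_opZ // bounded_opD // bounded_opZ.
have [_ [M M0 AM]] := Ab; have [_ [N N0 BN]] := Bb.
exists (M * N) => [|x /=]; first exact: mulr_ge0.
by rewrite (le_trans (AM _)) // -mulrA ler_wpM2l.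
Qed.

Lemma bounded_opDf {V W : normedModType R} {A B : V -> W} :
  bounded_op A -> bounded_op B -> bounded_op (A \+ B).
Proof.
move=> Ab Bb; split=> [a x y /=|].
  rewrite !(bounded_opD Ab, bounded_opD Bb, bounded_opZ Ab, bounded_opZ Bb).
  by rewrite scalerDr addrACA.
have [_ [M M0 AM]] := Ab; have [_ [N N0 BN]] := Bb.
exists (M + N) => [|x /=]; first exact: addr_ge0.
by rewrite (le_trans (ler_normD _ _)) // mulrDl lerD.
Qed.

Lemma bounded_opZf {V W : normedModType R} (a : R) {A : V -> W} :
  bounded_op A -> bounded_op (fun x => a *: A x).
Proof.
move=> Ab; split=> [b x y /=|].
  by rewrite (bounded_opD Ab) (bounded_opZ Ab) scalerDr !scalerA mulrC.
have [_ [M M0 AM]] := Ab; exists (`|a| * M) => [|x]; first exact: mulr_ge0.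
by rewrite normrZ -mulrA ler_wpM2l.
Qed.

Lemma bounded_op_id {V : normedModType R} : bounded_op (@id V).
Proof. by split=> //; exists 1 => // x; rewrite mul1r. Qed.

Lemma opnorm_ge0 {V W : normedModType R} (A : V -> W) : 0 <= opnorm A.
Proof.
have [S0|S0] := pselect (has_sup [set `|A x| | x in [set x : V | `|x| <= 1]]).
  rewrite (le_trans (normr_ge0 (A 0))) //; apply: (sup_upper_bound S0).
  by exists 0 => //=; rewrite normr0.
(* A set without supremum has [sup] equal to 0 by convention. *)
by rewrite /opnorm sup_out.
Qed.

Lemma opnorm_le {V W : normedModType R} (A : V -> W) x :
  bounded_op A -> `|A x| <= opnorm A * `|x|.
Proof.
move=> Ab; have [->|x0] := eqVneq x 0; first by rewrite (bounded_op0 Ab) !normr0 mulr0.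
have nx0 : 0 < `|x| by rewrite normr_gt0.
rewrite -ler_pdivrMr // mulrC -[X in X * _]gtr0_norm ?invr_gt0 //.
rewrite -normrZ -(bounded_opZ Ab); apply: ub_le_sup.
  have [_ [M M0 AM]] := Ab; exists M => _ [y /= y1 <-].
  by rewrite (le_trans (AM _)) // ler_piMr.
exists (`|x|^-1 *: x) => //=.
by rewrite normrZ gtr0_norm ?invr_gt0 // mulVf // gt_eqF.
Qed.

End Bounded.

Section InnerBounded.
Context {R : realType} {E : hilbertType R}.

Lemma bounded_op_inner (g : E) : bounded_op (fun h => inner g h : R).
Proof.
split=> [a x y|]; first by rewrite innerDr innerZr.
by exists `|g| => // x; exact: normr_inner_le.
Qed.

End InnerBounded.

(** * Cauchy sequences with an explicit rate *)

Section CauchySequences.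
Context {R : realType} {E : completeNormedModType R}.

Lemma dominated_cauchy_cvg {x : nat -> E} {e : nat -> R} :
  e n @[n --> \oo] --> (0 : R) ->
  (forall n p, (n <= p)%N -> `|x n - x p| <= e n) -> cvgn x.
Proof.
move=> e0 xe; apply/cauchy_cvgP/cauchy_exP => _/posnumP[d].
have [N _ eN] : \forall n \near \oo, `|e n| < d%:num by exact: cvgr0_norm_lt.
exists (x N); exists N => // p /= Np; rewrite -ball_normE /=.
by rewrite (le_lt_trans (xe _ _ Np)) // (le_lt_trans (ler_norm _)) // eN /=.
Qed.

Lemma dominated_cauchy_dist {x : nat -> E} {e : nat -> R} :
  e n @[n --> \oo] --> (0 : R) ->
  (forall n p, (n <= p)%N -> `|x n - x p| <= e n) ->
  forall n, `|x n - limn x| <= e n.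
Proof.
move=> e0 xe n; have xc := dominated_cauchy_cvg e0 xe.
(* With [n] fixed, the bound survives the limit in [p]. *)
have : `|x n - x p| @[p --> \oo] --> `|x n - limn x|.
  by apply: cvg_norm; apply: cvgB; [exact: cvg_cst|].
move=> /cvg_lim <- //; apply: limr_le; last by exists n => // p /= /xe.
by apply: is_cvg_norm; apply: is_cvgB => //; exact: is_cvg_cst.
Qed.

Lemma dominated_cvg {x : nat -> E} {e : nat -> R} {l : E} :
  e n @[n --> \oo] --> (0 : R) -> (forall n, `|x n - l| <= e n) ->
  x n @[n --> \oo] --> l.
Proof.
move=> e0 xe; apply/cvgrPdist_lt => _/posnumP[d].
have [N _ eN] : \forall n \near \oo, `|e n| < d%:num by exact: cvgr0_norm_lt.
exists N => // p /= Np; rewrite distrC.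
by rewrite (le_lt_trans (xe _)) // (le_lt_trans (ler_norm _)) // eN /=.
Qed.

End CauchySequences.

(** * The Riesz representation theorem *)

Section Riesz.
Context {R : realType} {E : hilbertType R}.

(* The representing vector minimizes [|x|^2 - 2 f x]; by the parallelogram law
   minimizing sequences are Cauchy. *)
Lemma riesz {f : E -> R} : bounded_op f -> exists g, forall h, f h = inner g h.
Proof.
move=> fb; pose J x := `|x| ^+ 2 - 2 * f x.
have Jmid x y : `|x - y| ^+ 2 = 2 * (J x + J y - 2 * J (2^-1 *: (x + y))).
  rewrite /J (bounded_opZ fb) (bounded_opD fb) normrZ exprMn !normD2 normrN innerNr.
  by rewrite ger0_norm ?invr_ge0 // /GRing.scale /=; field.
have [_ [M M0 fM]] := fb.
have Jlb : has_lbound (range J).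
  exists (- M ^+ 2) => _ [x _ <-]; rewrite /J.
  have := fM x; rewrite ler_norml => /andP[_ fx].
  by have := sqr_ge0 (`|x| - M); nra.
have Jinf : has_inf (range J) by split=> //; exists (J 0), 0.
(* With this factor 1/2 the bound 2 (e_n^2 + e_p^2) <= 4 e_n^2 obtained from [Jmid] is the square of
   [harmonic n]. *)
pose e n : R := 2^-1 * harmonic n.
have e_gt0 n : 0 < e n by rewrite mulr_gt0 // harmonic_gt0.
have ex_n n : exists x, J x < inf (range J) + e n ^+ 2.
  have [_ [x _ <-] xn] := inf_adherent (exprn_gt0 2 (e_gt0 n)) Jinf.
  by exists x.
have [x xn] := choice ex_n.
have Jge y : inf (range J) <= J y by apply: ge_inf => //; exists y.
have xc n p : (n <= p)%N -> `|x n - x p| <= harmonic n :> R.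
  move=> np; rewrite -ler_sqr ?nnegrE ?harmonic_ge0 // Jmid.
  have := xn n; have := xn p; have := Jge (2^-1 *: (x n + x p)).
  have : e p ^+ 2 <= e n ^+ 2.
    rewrite ler_sqr ?nnegrE ?(ltW (e_gt0 _)) // ler_pM2l ?invr_gt0 //.
    by rewrite lef_pV2 ?posrE // ler_nat ltnS.
  by rewrite /e; nra.
have xcv := dominated_cauchy_cvg cvg_harmonic xc.
pose g := limn x.
have Jc : J (x n) @[n --> \oo] --> J g.
  apply: cvgB; first by apply: cvgM; exact: cvg_norm.
  apply: cvgM; [exact: cvg_cst|apply: cvg_comp xcv _].
  exact: (bounded_op_continuous fb).
have e0 : e n @[n --> \oo] --> (0 : R).
  by rewrite -(mulr0 2^-1); apply: cvgM; [exact: cvg_cst|exact: cvg_harmonic].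
have Jg : J g <= inf (range J).
  rewrite -[leRHS]addr0 -(mulr0 0).
  apply: (ler_cvg_to Jc (cvgD (cvg_cst _) (cvgM e0 e0))).
  by apply: nearW => n; exact: ltW (xn n).
exists g => h; apply/eqP; rewrite -subr_eq0; set d := _ - _.
(* Minimality of [g] along the line g + t h; [d] is f h - <g, h>. *)
have dle t : 2 * t * d <= t ^+ 2 * `|h| ^+ 2.
  have := le_trans Jg (Jge (g + t *: h)).
  rewrite /J normD2 (bounded_opD fb) (bounded_opZ fb) innerZr normrZ exprMn.
  by rewrite real_normK ?num_real // /d /GRing.scale /=; nra.
(* This [t] turns the inequality into (d / (a + 1))^2 (a + 2) <= 0; the added 1 keeps the
   denominator positive when h = 0. *)
have := dle (d / (`|h| ^+ 2 + 1)); set a := `|h| ^+ 2.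
have a0 : 0 <= a by rewrite sqr_ge0.
have a1 : 0 < a + 1 by rewrite ltr_wpDl.
rewrite expr_div_n -subr_ge0.
have -> : d ^+ 2 / (a + 1) ^+ 2 * a - 2 * (d / (a + 1)) * d =
  - ((d / (a + 1)) ^+ 2 * (a + 2)) by field; rewrite gt_eqF.
rewrite oppr_ge0 pmulr_lle0 ?ltr_wpDl // => d0.
have : (d / (a + 1)) ^+ 2 == 0 by rewrite eq_le d0 sqr_ge0.
by rewrite sqrf_eq0 mulf_eq0 invr_eq0 (gt_eqF a1) orbF.
Qed.
End Riesz.

(** * Existence of the adjoint *)

Section Adjoint.
Context {R : realType} {E F : hilbertType R} {A : E -> F}.
Hypothesis Ab : bounded_op A.

(** [adjoint] is chosen by [get], so a witness has to be built: Riesz gives it pointwise, testing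
    against all vectors gives linearity, and |A' y|^2 = <A (A' y), y> gives the bound. *)
Lemma adjoint_spec : continuous (adjoint A) /\
  forall x y, inner (A x) y = inner x (adjoint A y).
Proof.
have ex y : exists g, forall x, inner (A x) y = inner x g.
  have [|g gP] := @riesz R E (fun x => inner y (A x)).
    exact: bounded_op_comp (bounded_op_inner y) Ab.
  by exists g => x; rewrite innerC gP innerC.
have [A' A'P] := choice ex.
have A'l : linear A'.
  by move=> a y z; apply: innerI => x; rewrite !innerE ![inner (A' _) _]innerC
    -!A'P !innerE.
have A'b : bounded_op A'.
  split=> //; have [_ [M M0 AM]] := Ab; exists M => // y.
  have [->|y0] := eqVneq (A' y) 0; first by rewrite normr0 mulr_ge0.
  rewrite -(ler_pM2l (_ : 0 < `|A' y|)) ?normr_gt0 // -expr2 -inner_norm -A'P.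
  by rewrite (le_trans (inner_le _ _)) // mulrA ler_wpM2r // mulrC.
have [A'' A''E A''c] := bounded_op_linear A'b.
apply: (@getPex _ [set A' : {linear F -> E} |
  continuous A' /\ forall x y, inner (A x) y = inner x (A' y)]).
by exists A''; split=> // x y; rewrite -A''E.
Qed.

Lemma bounded_op_adjoint : bounded_op (adjoint A).
Proof. by apply: continuous_bounded_op; case: adjoint_spec. Qed.

Lemma adjointP x y : inner (A x) y = inner x (adjoint A y).
Proof. by case: adjoint_spec. Qed.

End Adjoint.

(** * Gradients with respect to a given inner product *)

Section HasGradient.
Context {R : realType}.

(** Differentiability is recorded along with the representing vector, since [gradient] alone may be
    an arbitrary default value. *)
Definition has_grad {W : normedModType R} (ip : W -> W -> R) (f : W -> R)
    (x g : W) : Prop :=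
  differentiable f x /\ forall h, 'd f x h = ip g h.

Lemma has_gradE {W : normedModType R} (ip : W -> W -> R) (f : W -> R) (x g : W) :
  (forall y z, (forall h, ip y h = ip z h) -> y = z) ->
  has_grad ip f x g -> gradient ip f x = g.
Proof.
move=> ipI [_ fg]; apply: ipI => h; rewrite -fg.
have /getPex/(_ h) <- // : exists g', [set g | forall h, 'd f x h = ip g h] g'.
by exists g.
Qed.

Lemma has_gradD {W : normedModType R} (ip : W -> W -> R) (f1 f2 : W -> R) x g1 g2 :
  (forall y z h, ip (y + z) h = ip y h + ip z h) ->
  has_grad ip f1 x g1 -> has_grad ip f2 x g2 ->
  has_grad ip (fun y => f1 y + f2 y) x (g1 + g2).
Proof.
move=> ipD [f1d f1g] [f2d f2g]; split=> [|h]; first exact: differentiableD.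
by rewrite (diffD f1d f2d) /= f1g f2g ipD.
Qed.

(** A quadratic remainder is o(h); the explicit functionals below are differentiated through
    this. *)
Lemma quadratic_diff {W : normedModType R} (f l : W -> R) (x : W) (M : R) :
  bounded_op l -> (forall h, `|f (x + h) - f x - l h| <= M * `|h| ^+ 2) ->
  differentiable f x /\ forall h, 'd f x h = l h.
Proof.
move=> lb; have [l' -> l'c] := bounded_op_linear lb => fM.
suff fo : f \o shift x = cst (f x) + l' +o_ 0 id.
  have dl : 'd f x = l' :> (W -> R) by exact: diff_unique.
  by split=> [|h]; [apply/diff_locallyP; rewrite dl|rewrite dl].
apply/eqaddoP => _/posnumP[e]; near=> h.
rewrite -[X in `|X|]/(f (h + x) - (f x + l' h)) opprD addrA [h + x]addrC.
rewrite (le_trans (fM h)) // expr2 mulrA ler_wpM2r //.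
(* On this ball M |h| <= e; adding 1 to |M| avoids division by zero. *)
have hM : `|h| <= e%:num / (`|M| + 1).
  near: h; apply/nbhs_norm0P; exists (e%:num / (`|M| + 1)) => //= k; exact: ltW.
have M1 : 0 < `|M| + 1 by rewrite ltr_wpDl.
rewrite (@le_trans _ _ ((`|M| + 1) * `|h|)) //.
  by rewrite ler_wpM2r // (le_trans (ler_norm M)) // lerDl.
by rewrite mulrC -ler_pdivlMr.
Unshelve. all: by end_near. Qed.

Lemma diff_comp_bounded_op {V W : normedModType R} (L : V -> W) (f : W -> R) x :
  bounded_op L -> differentiable f (L x) ->
  differentiable (fun y => f (L y)) x /\
  forall h, 'd (fun y => f (L y)) x h = 'd f (L x) (L h).
Proof.
move=> Lb; have [L' -> L'c] := bounded_op_linear Lb => fd.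
have Ld : differentiable L' x by exact: linear_differentiable.
split=> [|h]; first exact: (differentiable_comp Ld fd).
by rewrite (diff_comp Ld fd) /= diff_lin.
Qed.

End HasGradient.

(** * Gradients of quadratic functionals and of functions on a product *)

Section HilbertGradients.
Context {R : realType} {E F : hilbertType R}.

Lemma has_grad_quadratic (f : E -> R) (x g : E) (M : R) :
  (forall h, `|f (x + h) - f x - inner g h| <= M * `|h| ^+ 2) ->
  has_grad (@inner R E) f x g.
Proof. exact: quadratic_diff (bounded_op_inner g). Qed.

Lemma grad_eq (f : E -> R) (x g : E) : has_grad (@inner R E) f x g -> grad f x = g.
Proof. by apply: has_gradE; exact: innerI. Qed.

(** Riesz supplies the representing vector, so [grad] has its intended value wherever [f] is
    differentiable. *)
Lemma has_grad_grad (f : E -> R) (x : E) :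
  differentiable f x -> has_grad (@inner R E) f x (grad f x).
Proof.
move=> fd; split=> // h.
have fc : continuous ('d f x) by exact: diff_continuous.
have [g gP] := riesz (continuous_bounded_op fc).
by rewrite gP (@grad_eq f x g).
Qed.

Lemma has_gradZ (f : E -> R) (x g : E) (a : R) :
  has_grad (@inner R E) f x g -> has_grad (@inner R E) (fun y => a * f y) x (a *: g).
Proof.
move=> [fd fg]; split=> [|h]; first exact: (differentiableZ a fd).
by rewrite (diffZ a fd) /= fg innerZl.
Qed.

(** The remainder is exactly |L h|^2 / 2. This serves both the one-step cost and the shaped
    potential. *)
Lemma has_grad_normD2 (L : E -> F) (Ls : F -> E) (a : F) (x : E) :
  bounded_op L -> (forall y z, inner (L y) z = inner y (Ls z)) ->
  has_grad (@inner R E) (fun y => 2^-1 * `|a + L y| ^+ 2) x (Ls (a + L x)).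
Proof.
move=> Lb LLs; have [_ [M M0 LM]] := Lb.
apply: (@has_grad_quadratic _ _ _ (2^-1 * M ^+ 2)) => h.
rewrite (bounded_opD Lb) addrA (normD2 (a + L x)) (innerC (Ls _)) -LLs (innerC (L h)).
rewrite [X in `|X|](_ : _ = 2^-1 * `|L h| ^+ 2); last by field.
rewrite ger0_norm ?mulr_ge0 ?sqr_ge0 ?invr_ge0 // -mulrA ler_pM2l ?invr_gt0 //.
by rewrite -exprMn ler_sqr ?nnegrE ?mulr_ge0.
Qed.

(** Self-adjointness merges the two mixed terms and leaves the remainder <h, A h> / 2; used for the
    kinetic energy with A = T^-1. *)
Lemma has_grad_form (A : E -> E) (x : E) :
  bounded_op A -> selfadjoint A ->
  has_grad (@inner R E) (fun y => 2^-1 * inner y (A y)) x (A x).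
Proof.
move=> Ab As; have [_ [M M0 AM]] := Ab.
apply: (@has_grad_quadratic _ _ _ (2^-1 * M)) => h.
rewrite (bounded_opD Ab) !innerE -(As x h) (innerC h (A x)).
rewrite [X in `|X|](_ : _ = 2^-1 * inner h (A h)); last by field.
rewrite normrM ger0_norm ?invr_ge0 // -mulrA ler_pM2l ?invr_gt0 //.
rewrite (le_trans (normr_inner_le _ _)) // mulrC expr2 mulrA ler_wpM2r //.
Qed.

Lemma has_grad_affine (g a x : E) :
  has_grad (@inner R E) (fun y => inner g (y - a)) x g.
Proof.
apply: (@has_grad_quadratic _ _ _ 0) => h.
by rewrite !innerDr [X in `|X|](_ : _ = 0) ?normr0 ?mul0r //; ring.
Qed.

Lemma prod_inner_I (y z : E * F) :
  (forall h, prod_inner y h = prod_inner z h) -> y = z.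
Proof.
case: y z => [y1 y2] [z1 z2] h; congr (_, _); apply: innerI => x.
  by have := h (x, 0); rewrite /prod_inner /= !inner0r !addr0.
by have := h (0, x); rewrite /prod_inner /= !inner0r !add0r.
Qed.

Lemma prod_innerDl (x y z : E * F) :
  prod_inner (x + y) z = prod_inner x z + prod_inner y z.
Proof. by rewrite /prod_inner /= !innerDl addrACA. Qed.

Lemma has_grad_fst (f : E -> R) (z : E * F) g :
  has_grad (@inner R E) f z.1 g ->
  has_grad (@prod_inner R E F) (fun w => f w.1) z (g, 0).
Proof.
move=> [fd fg]; have [|cd ch] := @diff_comp_bounded_op _ (E * F)%type _ fst f z _ fd.
  (* The product norm is the maximum of the two norms, so the projection has bound 1. *)
  split=> [//|]; exists 1 => // w; rewrite mul1r prod_normE.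
  by rewrite le_max lexx.
by split=> // h; rewrite ch fg /prod_inner /= inner0l addr0.
Qed.

Lemma has_grad_snd (f : F -> R) (z : E * F) g :
  has_grad (@inner R F) f z.2 g ->
  has_grad (@prod_inner R E F) (fun w => f w.2) z (0, g).
Proof.
move=> [fd fg]; have [|cd ch] := @diff_comp_bounded_op _ (E * F)%type _ snd f z _ fd.
  split=> [//|]; exists 1 => // w; rewrite mul1r prod_normE.
  by rewrite le_max lexx orbT.
by split=> // h; rewrite ch fg /prod_inner /= inner0l add0r.
Qed.

End HilbertGradients.

(** * Inverses of bijective operators *)

Section Inverse.
Context {R : realType} {E : hilbertType R} {A : E -> E}.

Lemma opinvK : bijective A -> cancel (opinv A) A.
Proof.
move=> Abij y; apply: pinvK; rewrite inE.
by case: Abij => Ai _ AAi; exists (Ai y).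
Qed.

Lemma opinv_selfadjoint : bijective A -> selfadjoint A -> selfadjoint (opinv A).
Proof.
by move=> Abij Asa x y; rewrite -{2}(opinvK Abij x) Asa opinvK.
Qed.

Lemma opinv_bounded (m : R) : bijective A -> bounded_op A -> 0 < m ->
  (forall x, m * `|x| <= `|A x|) -> bounded_op (opinv A).
Proof.
move=> Abij Ab m0 mA; split=> [a x y|].
  apply: (bij_inj Abij).
  by rewrite opinvK // (bounded_opD Ab) (bounded_opZ Ab) !opinvK.
exists m^-1 => [|x]; first by rewrite invr_ge0 ltW.
by rewrite ler_pdivlMl // (le_trans (mA _)) // opinvK.
Qed.

End Inverse.

(** * Inverse and positive square root of I - K for self-adjoint K with |K x| <= k |x|, k < 1 *)

Section NearIdentity.
Context {R : realType} {E : hilbertType R} {K : E -> E} {k : R}.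
Hypotheses (Kb : bounded_op K) (Ksa : selfadjoint K).
Hypotheses (k0 : 0 <= k) (k1 : k < 1) (Kk : forall x, `|K x| <= k * `|x|).

Local Notation T := (fun x => x - K x).

Let k_def : 0 < 1 - k. Proof. by rewrite subr_gt0. Qed.

Let T_lower x : (1 - k) * `|x| <= `|T x|.
Proof.
rewrite mulrBl mul1r lerBlDr -[X in `|X| <= _](subrK (K x)).
by rewrite (le_trans (ler_normD _ _)) // lerD2l.
Qed.

Lemma near_id_bounded : bounded_op T.
Proof.
have := bounded_opDf bounded_op_id (bounded_opZf (-1) Kb).
by under [X in bounded_op X]funext do rewrite /= scaleN1r.
Qed.

Lemma near_id_selfadjoint : selfadjoint T.
Proof. by move=> x y; rewrite !innerE Ksa. Qed.

Lemma near_id_posdef : posdef T.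
Proof.
move=> x x0; rewrite innerDl innerNl inner_norm subr_gt0.
rewrite (le_lt_trans (inner_le _ _)) // (@le_lt_trans _ _ (k * `|x| ^+ 2)) //.
  by rewrite expr2 mulrA ler_wpM2r.
by rewrite gtr_pMl // exprn_gt0 // normr_gt0.
Qed.

(** Injectivity comes from [T_lower]; for surjectivity, x - K x = y is the fixed point equation x =
    y + K x of a k-contraction. *)
Lemma near_id_bij : bijective T.
Proof.
have Tinj : injective T.
  move=> x y Txy; apply/eqP; rewrite -subr_eq0 -normr_le0.
  rewrite -(pmulr_rle0 _ k_def) (le_trans (T_lower _)) //.
  by rewrite (bounded_opB Kb) opprD addrACA -opprD Txy subrr normr0.
have Tsurj y : exists x, T x = y.
  pose f0 x := y + K x.
  pose f : {fun [set: E] >-> [set: E]} :=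
    HB.pack f0 (isFun.Build E E setT setT f0 (fun _ _ => I)).
  have [||x _ xf] := @banach_fixed_point R E setT f _ closedT.
  - exists (NngNum k0); split=> //= -[u v] _ /=.
    by rewrite /f0 opprD addrACA subrr add0r -(bounded_opB Kb).
  - by exists 0.
  - by exists x; rewrite {1}xf addrK.
have [Ti TiP] := choice Tsurj.
by exists Ti => // x; apply: Tinj.
Qed.

Lemma near_id_opinv_bounded : bounded_op (opinv T).
Proof. exact: opinv_bounded near_id_bij near_id_bounded k_def T_lower. Qed.

(* [(I - Y)^2 = I - K] means [Y = (K + Y^2) / 2]; this map is a [k]-contraction
   of the operators of norm at most [k], and we iterate it from 0. *)
Definition sqrt_iter (n : nat) : E -> E :=
  iter n (fun Y x => 2^-1 *: (K x + Y (Y x))) (fun=> 0).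

Lemma sqrt_iterS n x :
  sqrt_iter n.+1 x = 2^-1 *: (K x + sqrt_iter n (sqrt_iter n x)).
Proof. by []. Qed.

(** The induction closes because (k + k^2) / 2 <= k for 0 <= k < 1. *)
Lemma sqrt_iter_le n x : `|sqrt_iter n x| <= k * `|x|.
Proof.
elim: n x => [|n IH] x; first by rewrite normr0 mulr_ge0.
rewrite sqrt_iterS normrZ ger0_norm ?invr_ge0 // ler_pdivrMl //.
rewrite mulr_natl mulr2n (le_trans (ler_normD _ _)) // lerD //.
rewrite (le_trans (IH _)) // ler_wpM2l // (le_trans (IH _)) //.
by rewrite ler_piMl // ltW.
Qed.

Lemma sqrt_iter_linear n : linear (sqrt_iter n).
Proof.
elim: n => [|n IH] a x y; first by rewrite /sqrt_iter /= scaler0 addr0.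
rewrite !sqrt_iterS !IH (bounded_opD Kb) (bounded_opZ Kb).
by rewrite addrACA -(scalerDr a) (scalerDr 2^-1 (a *: _)) !scalerA mulrC.
Qed.

Lemma sqrt_iter_bounded n : bounded_op (sqrt_iter n).
Proof.
by split; [exact: sqrt_iter_linear|exists k => // x; exact: sqrt_iter_le].
Qed.

Lemma sqrt_iter_selfadjoint n : selfadjoint (sqrt_iter n).
Proof.
elim: n => [|n IH] x y; first by rewrite /= inner0l inner0r.
by rewrite !sqrt_iterS !innerE !IH Ksa.
Qed.

Lemma sqrt_iter_step n x :
  `|sqrt_iter n x - sqrt_iter n.+1 x| <= k ^+ n.+1 * `|x|.
Proof.
elim: n x => [|n IH] x; first by rewrite sub0r normrN expr1 sqrt_iter_le.
rewrite [sqrt_iter n.+1 x]sqrt_iterS sqrt_iterS -scalerBr opprD addrACA subrr.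
rewrite add0r normrZ ger0_norm ?invr_ge0 // ler_pdivrMl //.
(* For consecutive iterates Y and Y', Y Y - Y' Y' = Y (Y - Y') + (Y - Y') Y'; each term is at most
   k^(n+2) |x|, and the factor 1/2 compensates for there being two. *)
rewrite -[X in `|X|](subrKA (sqrt_iter n (sqrt_iter n.+1 x))).
rewrite (le_trans (ler_normD _ _)) // mulr_natl mulr2n lerD //.
  rewrite -(bounded_opB (sqrt_iter_bounded n)) (le_trans (sqrt_iter_le _ _)) //.
  by rewrite exprS -mulrA ler_wpM2l.
rewrite (le_trans (IH _)) // [k ^+ n.+2]exprSr -mulrA ler_wpM2l ?exprn_ge0 //.
exact: sqrt_iter_le.
Qed.

(** With this constant, C k^n = k^(n+1) / (1 - k) is the sum of all step bounds from index [n]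
    on. *)
Let C := (1 - k)^-1 * k.

Let e (x : E) n : R := C * `|x| * k ^+ n.

Let e_cvg x : e x n @[n --> \oo] --> (0 : R).
Proof. by apply: cvg_geometric; rewrite ger0_norm. Qed.

Lemma sqrt_iter_cauchy x n p : (n <= p)%N ->
  `|sqrt_iter n x - sqrt_iter p x| <= e x n.
Proof.
move=> /subnKC <-; move: (p - n)%N => q; elim: q n => [|q IH] n.
  by rewrite addn0 subrr normr0 /e /C !mulr_ge0 ?exprn_ge0 // invr_ge0 ltW.
rewrite addnS -addSn -[X in `|X|](subrKA (sqrt_iter n.+1 x)).
rewrite (le_trans (ler_normD _ _)) //.
rewrite (le_trans (lerD (sqrt_iter_step _ _) (IH _))) //.
rewrite le_eqVlt; apply/orP; left; apply/eqP.
by rewrite /e /C exprS; field; rewrite gt_eqF.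
Qed.

Definition sqrt_lim x : E := limn (sqrt_iter ^~ x).

Lemma sqrt_iter_cvg x : sqrt_iter n x @[n --> \oo] --> sqrt_lim x.
Proof. exact: dominated_cauchy_cvg (e_cvg x) (sqrt_iter_cauchy x). Qed.

Lemma sqrt_iter_dist n x : `|sqrt_iter n x - sqrt_lim x| <= e x n.
Proof. exact: dominated_cauchy_dist (e_cvg x) (sqrt_iter_cauchy x) n. Qed.

Lemma sqrt_lim_le x : `|sqrt_lim x| <= k * `|x|.
Proof.
have xc : `|sqrt_iter n x| @[n --> \oo] --> `|sqrt_lim x|.
  by apply: cvg_norm; exact: sqrt_iter_cvg.
move/cvg_lim : (xc) => <- //; apply: limr_le.
  by apply/cvg_ex; eexists; exact: xc.
by apply: nearW => n; exact: sqrt_iter_le.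
Qed.

Lemma sqrt_lim_linear : linear sqrt_lim.
Proof.
move=> a x y; apply: (cvg_unique _ (sqrt_iter_cvg (a *: x + y))).
  exact: norm_hausdorff.
under [X in X @ _]funext do rewrite sqrt_iter_linear.
apply: cvgD; last exact: sqrt_iter_cvg.
by apply: cvgZr; exact: sqrt_iter_cvg.
Qed.

Lemma sqrt_lim_bounded : bounded_op sqrt_lim.
Proof. by split; [exact: sqrt_lim_linear|exists k => //; exact: sqrt_lim_le]. Qed.

Lemma sqrt_lim_selfadjoint : selfadjoint sqrt_lim.
Proof.
have ic x y : inner y (sqrt_iter n x) @[n --> \oo] --> inner y (sqrt_lim x).
  apply: cvg_comp (sqrt_iter_cvg x) _.
  exact: (bounded_op_continuous (bounded_op_inner y)).
move=> x y; rewrite innerC; apply: (cvg_unique _ (ic x y)).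
  exact: norm_hausdorff.
under [X in X @ _]funext do rewrite -sqrt_iter_selfadjoint innerC.
exact: ic.
Qed.

Lemma sqrt_lim_eq x : 2 *: sqrt_lim x = K x + sqrt_lim (sqrt_lim x).
Proof.
have YY : sqrt_iter n (sqrt_iter n x) @[n --> \oo] --> sqrt_lim (sqrt_lim x).
  (* The error is split as Y_n (Y_n x - Y x) + (Y_n - Y) (Y x): the uniform bound k controls the
     first part, the rate at Y x the second. *)
  apply: (@dominated_cvg _ _ _ (fun n => k * e x n + e (sqrt_lim x) n)).
    rewrite -[X in _ --> X]addr0 -[X in _ --> X + _](mulr0 k).
    by apply: cvgD => //; apply: cvgM => //; exact: cvg_cst.
  move=> n; rewrite -[X in `|X|](subrKA (sqrt_iter n (sqrt_lim x))).
  rewrite (le_trans (ler_normD _ _)) // lerD ?sqrt_iter_dist //.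
  rewrite -(bounded_opB (sqrt_iter_bounded n)) (le_trans (sqrt_iter_le _ _)) //.
  by rewrite ler_wpM2l // sqrt_iter_dist.
suff {1}-> : sqrt_lim x = 2^-1 *: (K x + sqrt_lim (sqrt_lim x)).
  by rewrite scalerA mulfV ?scale1r.
have := sqrt_iter_cvg x; rewrite -cvg_shiftS => xc.
apply: (cvg_unique _ xc); first exact: norm_hausdorff.
by apply: cvgZr; apply: cvgD YY; exact: cvg_cst.
Qed.

(** The root is I - Y with Y = [sqrt_lim]: its square I - 2 Y + Y^2 equals I - K by [sqrt_lim_eq],
    and it is positive since |Y x| <= |x|. *)
Lemma near_id_opsqrt : is_opsqrt T (opsqrt T).
Proof.
have Sb : bounded_op (fun x => x - sqrt_lim x).
  have := bounded_opDf bounded_op_id (bounded_opZf (-1) sqrt_lim_bounded).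
  by under [X in bounded_op X]funext do rewrite /= scaleN1r.
have [S SE Sc] := bounded_op_linear Sb.
apply: (@getPex _ (is_opsqrt T)); exists S; split; rewrite -?SE //.
- by rewrite SE.
- by move=> x y /=; rewrite !innerE sqrt_lim_selfadjoint.
- move=> x /=; rewrite innerDl innerNl inner_norm subr_ge0.
  rewrite (le_trans (inner_le _ _)) // expr2 ler_wpM2r //.
  by rewrite (le_trans (sqrt_lim_le _)) // ler_piMl // ltW.
- move=> x /=; rewrite (bounded_opB sqrt_lim_bounded).
  rewrite -[K x](addrK (sqrt_lim (sqrt_lim x))).
  by rewrite -sqrt_lim_eq scaler_nat mulr2n !opprD !opprK !addrA.
Qed.

End NearIdentity.

(** * Invertibility of the square root *)

Section SqrtInverse.
Context {R : realType} {E : hilbertType R} {T : E -> E} {S : {linear E -> E}}.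
Hypotheses (Tbij : bijective T) (ST : is_opsqrt T S).

Let Sb : bounded_op S.
Proof. by case: ST => Sc _ _ _; exact: continuous_bounded_op. Qed.

Let SS x : S (S x) = T x. Proof. by case: ST. Qed.

Lemma opsqrt_comm x : S (T x) = T (S x). Proof. by rewrite -!SS. Qed.

Lemma opsqrt_bij : bijective S.
Proof.
have Sinj : injective S.
  by move=> x y Sxy; apply: (bij_inj Tbij); rewrite -!SS Sxy.
exists (S \o opinv T) => [x|x] /=; last by rewrite SS opinvK.
by apply: Sinj; rewrite SS opinvK.
Qed.

(** Writing T^(-1/2) as T^(1/2) T^-1 shows below that it is bounded. *)
Lemma opinv_opsqrt : opinv S = S \o opinv T.
Proof.
apply/funext => x /=; apply: (bij_inj opsqrt_bij).
by rewrite SS !opinvK //; exact: opsqrt_bij.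
Qed.

End SqrtInverse.

(** * Derivatives of pairs of curves *)

Section Derivatives.
Context {R : realType} {V W : normedModType R}.

Lemma has_deriv_pair (x : R -> V) (y : R -> W) t v w :
  has_deriv (fun s => (x s, y s)) t (v, w) <-> has_deriv x t v /\ has_deriv y t w.
Proof.
split=> [xy|[xv yw]]; last exact: cvg_pair xv yw.
split.
  exact: (cvg_comp _ _ xy (@cvg_fst _ _ (nbhs v) (nbhs w) _)).
exact: (cvg_comp _ _ xy (@cvg_snd _ _ (nbhs v) (nbhs w) _)).
Qed.

End Derivatives.

(** * Gradient of the closed-loop Hamiltonian and equivalence with (PH) *)

Section PortHamiltonianForm.
Context {R : realType} {E U : hilbertType R}.
Variables (VV : E -> R) (Psi : E -> {linear E -> E}) (B : {linear U -> E}).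
Variables (c1 : R) (T : E -> E) (Vhat : E -> R) (gVhat : E -> E) (G : E -> E -> E).
Hypotheses (VVd : forall X, differentiable VV X) (Tb : bounded_op T).
Hypotheses (Tsa : selfadjoint T) (Tpos : posdef T) (Tbij : bijective T).
Hypotheses (Tib : bounded_op (opinv T)) (ST : is_opsqrt T (opsqrt T)).
Hypothesis comm : forall x, opsqrt T (B (adjoint B x)) = B (adjoint B (opsqrt T x)).
Hypothesis Vhat_grad : forall X, has_grad (@inner R E) Vhat X (gVhat X).
Hypothesis GE : forall X V, G X V =
  - (c1 *: B (adjoint B V)) - T (Psi X V + grad VV X) - T (gVhat X).

Lemma has_grad_Hcl z :
  has_grad (@prod_inner R E E) (Hcl VV T Vhat) z
    (grad VV z.1 + gVhat z.1, opinv T z.2).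
Proof.
have Tisa := opinv_selfadjoint Tbij Tsa.
have hV := has_grad_snd _ z _ (has_grad_form (opinv T) z.2 Tib Tisa).
have hX := has_grad_fst (F := E) _ z _ (has_grad_grad _ _ (VVd z.1)).
have hh := has_grad_fst (F := E) _ z _ (Vhat_grad z.1).
have addl := @prod_innerDl R E E.
have := has_gradD _ _ _ _ _ _ addl (has_gradD _ _ _ _ _ _ addl hV hX) hh.
by congr has_grad; congr pair; rewrite /= ?add0r ?addr0.
Qed.

Lemma admits_PH_closed_loop : admits_PH VV Psi B c1 T Vhat G.
Proof.
split.
  split=> //; first by split=> //; exact: bounded_op_continuous.
  by move=> z; case: (has_grad_Hcl z).
move=> X0 V0 X V _ _.
(* At each state the two vector fields coincide, so the two notions of solution agree pointwise in
   [t]. *)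
have EG t : let z := prod_grad (Hcl VV T Vhat) (X t, V t) in
  PH_J T z - PH_R Psi B c1 T (X t) z = (V t, G (X t) (V t)).
  rewrite /prod_grad (has_gradE _ _ _ _ (@prod_inner_I _ _ _) (has_grad_Hcl _)) /=.
  rewrite /PH_J /PH_R /block_op /=; congr pair.
    by rewrite !add0r opinvK // subr0.
  (* The damping term T^(1/2) B B* T^(1/2) T^-1 V becomes B B* T T^-1 V = B B* V once T^(1/2) is
     moved past B B*. *)
  rewrite opinvK // comm (let: And4 _ _ _ SS := ST in SS) opinvK // GE.
  rewrite (bounded_opD Tb) (bounded_opD Tb (Psi _ _)).
  by apply: innerI => h; rewrite !innerE ?inner0l; ring.
suff : solves_2nd_order G X V <-> solves_PH VV Psi B c1 T Vhat X V.
  by move=> GH; split=> -[? ? /GH].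
by split=> GX t t0; have := GX t t0; rewrite /= EG has_deriv_pair.
Qed.

End PortHamiltonianForm.

(** * Gradient of the one-step cost and the resulting feedback *)

Section RollingHorizonFeedback.
Context {R : realType} {E U : hilbertType R}.
Variables (VV : E -> R) (Psi : E -> {linear E -> E}) (B : {linear U -> E}).
Variables (Xhat : E) (c dt rho : R).
Hypothesis Bc : continuous B.

Local Notation Bs := (adjoint B).
Local Notation Vdes := (fun X : E => c / 2 * `|X - Xhat| ^+ 2).
Local Notation c1 := (rho * dt ^+ 2 * (1 + c * dt ^+ 2)).
Local Notation c2 := (rho * dt ^+ 3 * (1 + c * dt ^+ 2)).
Local Notation c3 := (c * rho * dt ^+ 3).

Let Bb : bounded_op B := continuous_bounded_op Bc.
Let Bsb : bounded_op Bs := bounded_op_adjoint Bb.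

Let scaled_adjoint (a : R) y z : inner (a *: B y) z = inner y (a *: Bs z).
Proof. by rewrite innerZl innerZr (adjointP Bb). Qed.

(** The new velocity and the new position error are affine in [u], so [fd] is a combination of two
    squared norms. *)
Lemma has_grad_fd z u :
  let z' := Phi VV Psi B dt z.1 z.2 u in
  has_grad (@inner R U) (fd VV Psi B Vdes dt z) u
    (dt *: (dt *: Bs z'.2 + (c * dt ^+ 2) *: Bs (z'.1 - Xhat))).
Proof.
move=> z'; pose a := z.2 - dt *: (Psi z.1 z.2 + grad VV z.1).
have h1 := has_grad_normD2 _ _ a u (bounded_opZf dt Bb) (scaled_adjoint dt).
(* The control enters the position with dt^2, since that update uses the new velocity; [a] is this
   velocity without control. *)
have h2 := has_grad_normD2 _ _ (z.1 + dt *: a - Xhat) u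
  (bounded_opZf (dt ^+ 2) Bb) (scaled_adjoint (dt ^+ 2)).
have := has_gradZ _ _ _ dt
  (has_gradD _ _ _ _ _ _ (@innerDl _ _) h1 (has_gradZ _ _ _ c h2)).
have -> : z.1 + dt *: a - Xhat + dt ^+ 2 *: B u = z'.1 - Xhat.
  by rewrite /z' /Phi /= -/a; apply: innerI => h; rewrite !innerE; ring.
rewrite scalerA; congr has_grad; apply/funext => v.
rewrite /fd /Hdes /Phi /= -/a; congr (_ * (_ + _)).
rewrite mulrA; congr (_ * `|_| ^+ 2).
by apply: innerI => h; rewrite !innerE; ring.
Qed.

(** After substituting the position update, B* of the new velocity carries the factor rho dt^2 (1 +
    c dt^2) = c1; drift and B u0 enter that velocity with a further dt, whence c2 = c1 dt. The guess
    stays arbitrary to serve both cases. *)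
Lemma irh_stepE u0 l z :
  irh_step VV Psi B Vdes dt (fun=> rho) u0 l z =
  - (c1 *: Bs z.2) + c2 *: Bs (Psi z.1 z.2 + grad VV z.1)
  - (c3 *: Bs (z.1 - Xhat) - u0 l + c2 *: Bs (B (u0 l))).
Proof.
rewrite /irh_step (grad_eq _ _ _ (has_grad_fd _ _)) /Phi /=.
move: (Psi _ _ + _) => w; apply: innerI => h.
by rewrite !(bounded_opD Bsb, bounded_opN Bsb, bounded_opZ Bsb) !innerE; ring.
Qed.

(** When [G] is the uncontrolled acceleration plus B alpha, [Phi] under the feedback is one Euler
    step for [G]. *)
Lemma irh_state_euler u0 (alpha G : E -> E -> _) X0 V0 :
  (forall l z, irh_step VV Psi B Vdes dt (fun=> rho) u0 l z = alpha z.1 z.2) ->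
  (forall X V, G X V = - (Psi X V + grad VV X) + B (alpha X V)) ->
  forall l, irh_state VV Psi B Vdes dt (fun=> rho) u0 X0 V0 l =
    semi_explicit_euler dt G X0 V0 l.
Proof.
move=> ua Ga; elim=> [//|l IH] /=; rewrite ua IH.
case: semi_explicit_euler => X V /=; rewrite /Phi.
by rewrite Ga !(scalerDr dt (- _)) scalerN addrA.
Qed.

End RollingHorizonFeedback.

(** * The shaped potential, its gradient under T, and the closed loop as (PH) *)

Section ClosedLoop.
Context {R : realType} {E U : hilbertType R}.
Variables (VV : E -> R) (Psi : E -> {linear E -> E}) (B : {linear U -> E}).
Variables (Xhat : E) (c1 c2 c3 : R).
Hypotheses (VVd : forall X, differentiable VV X) (Bc : continuous B).
Hypotheses (c2_gt0 : 0 < c2).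

Local Notation Bs := (adjoint B).
Hypothesis c2_small : c2 * opnorm (fun x : E => B (Bs x)) < 1.

Local Notation T := (fun x : E => x - c2 *: B (Bs x)).
Local Notation Tmh := (opinv (opsqrt T)).
Local Notation k := (c2 * opnorm (fun x : E => B (Bs x))).

Let Bb : bounded_op B := continuous_bounded_op Bc.
Let Bsb : bounded_op Bs := bounded_op_adjoint Bb.
Let BBb : bounded_op (fun x : E => B (Bs x)) := bounded_op_comp Bb Bsb.
Let Kb : bounded_op (fun x => c2 *: B (Bs x)) := bounded_opZf c2 BBb.

Let Ksa : selfadjoint (fun x => c2 *: B (Bs x)).
Proof.
by move=> x y /=; rewrite !innerE (innerC x) !(adjointP Bb) (innerC (Bs x)).
Qed.

Let k0 : 0 <= k. Proof. by rewrite mulr_ge0 ?opnorm_ge0 // ltW. Qed.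

(** Together with [c2_small] this puts [T] in the form I - K treated above. *)
Let Kk x : `|c2 *: B (Bs x)| <= k * `|x|.
Proof.
by rewrite normrZ gtr0_norm // -mulrA ler_pM2l // (opnorm_le (fun x => B (Bs x))).
Qed.

Let Tb := near_id_bounded Kb.
Let Tsa := near_id_selfadjoint Ksa.
Let Tbij := near_id_bij Kb k0 c2_small Kk.
Let ST := near_id_opsqrt Kb Ksa k0 c2_small Kk.
Let Tib : bounded_op (opinv T) := near_id_opinv_bounded Kb k0 c2_small Kk.

Let Tmhb : bounded_op Tmh.
Proof.
rewrite (opinv_opsqrt Tbij ST); apply: bounded_op_comp Tib.
by case: ST => Sc _ _ _; exact: continuous_bounded_op.
Qed.

Let Sbij := opsqrt_bij Tbij ST.

(* [T^(1/2)] commutes with [T = I - c2 B B*], hence with [B B*] as [c2 <> 0]. *)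
Let comm x : opsqrt T (B (Bs x)) = B (Bs (opsqrt T x)).
Proof.
have := opsqrt_comm ST x; rewrite /= linearB linearZ => /addrI/oppr_inj.
by apply: scalerI; rewrite gt_eqF.
Qed.

Lemma has_grad_shaped_potential X :
  has_grad (@inner R E) (fun X : E => c3 / 2 * `|Bs (Tmh (X - Xhat))| ^+ 2) X
    (c3 *: Tmh (B (Bs (Tmh (X - Xhat))))).
Proof.
have Lb : bounded_op (fun x => Bs (Tmh x)) := bounded_op_comp Bsb Tmhb.
(* The adjoint of B* T^(-1/2) is T^(-1/2) B, as T^(-1/2) is self-adjoint. *)
have LLs y z : inner (Bs (Tmh y)) z = inner y (Tmh (B z)).
  rewrite innerC -(adjointP Bb) innerC; apply: opinv_selfadjoint => //.
  by case: ST.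
have := has_gradZ _ _ _ c3 (has_grad_normD2 _ _ (Bs (Tmh (- Xhat))) X Lb LLs).
have LE Y : Bs (Tmh (- Xhat)) + Bs (Tmh Y) = Bs (Tmh (Y - Xhat)).
  by rewrite (bounded_opD Tmhb) (bounded_opD Bsb) addrC.
by rewrite LE; congr has_grad; apply/funext => Y; rewrite LE mulrA.
Qed.

Lemma T_shaped_gradient X :
  T (c3 *: Tmh (B (Bs (Tmh (X - Xhat))))) = c3 *: B (Bs (X - Xhat)).
Proof.
etransitivity; [exact: (bounded_opZ Tb)|congr (_ *: _)].
(* With S = T^(1/2) and T = S^2, one factor S cancels the outer S^-1; the other passes B B* and
   cancels the inner one. *)
by case: (ST) => _ _ _ <-; rewrite (opinvK Sbij) comm (opinvK Sbij).
Qed.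

Lemma closed_loop_PH (Vhat : E -> R) (gVhat : E -> E) (G : E -> E -> E) :
  (forall X, has_grad (@inner R E) Vhat X (gVhat X)) ->
  (forall X V, G X V =
    - (c1 *: B (Bs V)) - T (Psi X V + grad VV X) - T (gVhat X)) ->
  admits_PH VV Psi B c1 T Vhat G.
Proof.
move=> hV GE; apply: admits_PH_closed_loop hV GE => //.
exact: (near_id_posdef c2_small Kk).
Qed.

End ClosedLoop.

Theorem corollary4p6 (R : realType) (E U : hilbertType R)
  (VV : E -> R) (Vlow C : R)
  (VV_C1 : C1_functional VV)
  (VV_low : forall X, Vlow <= VV X)
  (C_gt0 : 0 < C)
  (VV_grad : forall X, `|grad VV X| ^+ 2 <= C * (1 + VV X - Vlow))
  (Psi : E -> {linear E -> E})
  (Psi_cont : forall X, continuous (Psi X))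
  (Psi_bounded : exists M : R, forall X, opnorm (Psi X) <= M)
  (Psi_sa : forall X, selfadjoint (Psi X))
  (Psi_psd : forall X, possemidef (Psi X))
  (B : {linear U -> E})
  (B_cont : continuous B)
  (B_closed : closed (range B))
  (Xhat X0 V0 : E) (c dt rho : R)
  (c_ge0 : 0 <= c) (dt_gt0 : 0 < dt) (rho_gt0 : 0 < rho) :
  let Bs := adjoint B in
  let Vdes := fun X : E => c / 2 * `|X - Xhat| ^+ 2 in
  let c1 := rho * dt ^+ 2 * (1 + c * dt ^+ 2) in
  let c2 := rho * dt ^+ 3 * (1 + c * dt ^+ 2) in
  let c3 := c * rho * dt ^+ 3 in
  let T := fun x : E => x - c2 *: B (Bs x) in
  let Tmh := opinv (opsqrt T) in
  let state := fun u0 : nat -> U =>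
    irh_state VV Psi B Vdes dt (fun=> rho) u0 X0 V0 in
  let control := fun u0 : nat -> U =>
    irh_control VV Psi B Vdes dt (fun=> rho) u0 X0 V0 in
  (forall z u, differentiable (fd VV Psi B Vdes dt z) u) /\
  (* (i) *)
  (let u0 := fun=> 0 in
   let F := fun X : E => c3 *: Bs (X - Xhat) in
   let alpha := fun X V : E =>
     - (c1 *: Bs V) + c2 *: Bs (Psi X V + grad VV X) - F X in
   let G := fun X V : E =>
     - (c1 *: B (Bs V)) - T (Psi X V + grad VV X)
     - c3 *: B (Bs (X - Xhat)) in
   [/\ forall l, control u0 l = alpha (state u0 l).1 (state u0 l).2,
       forall l, state u0 l = semi_explicit_euler dt G X0 V0 l
     & c2 * opnorm (fun x : E => B (Bs x)) < 1 ->
       let Vhat := fun X : E => c3 / 2 * `|Bs (Tmh (X - Xhat))| ^+ 2 in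
       [/\ forall X, differentiable Vhat X,
           forall X, B (F X) = T (grad Vhat X)
         & admits_PH VV Psi B c1 T Vhat G]]) /\
  (* (ii) *)
  (forall ahat : U, B ahat = grad VV Xhat ->
   let u0 := fun=> ahat in
   let F := fun X : E =>
     c3 *: Bs (X - Xhat) - ahat + c2 *: Bs (grad VV Xhat) in
   let alpha := fun X V : E =>
     - (c1 *: Bs V) + c2 *: Bs (Psi X V + grad VV X) - F X in
   let G := fun X V : E =>
     - (c1 *: B (Bs V)) - T (Psi X V + grad VV X - grad VV Xhat)
     - c3 *: B (Bs (X - Xhat)) in
   [/\ forall l, control u0 l = alpha (state u0 l).1 (state u0 l).2,
       forall l, state u0 l = semi_explicit_euler dt G X0 V0 l
     & c2 * opnorm (fun x : E => B (Bs x)) < 1 ->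
       let Vhat := fun X : E =>
         c3 / 2 * `|Bs (Tmh (X - Xhat))| ^+ 2 - inner (grad VV Xhat) (X - Xhat) in
       [/\ forall X, differentiable Vhat X,
           forall X, B (F X) = T (grad Vhat X)
         & admits_PH VV Psi B c1 T Vhat G]]).
Proof.
move=> Bs Vdes c1 c2 c3 T Tmh state control.
have VVd X : differentiable VV X by case: VV_C1.
(* Strict positivity lets c2 be cancelled when B B* is extracted from T. *)
have c2_gt0 : 0 < c2.
  by rewrite /c2 !mulr_gt0 ?exprn_gt0 // ltr_wpDr // mulr_ge0 // exprn_ge0 // ltW.
have Bb := continuous_bounded_op B_cont.
have Bsb : bounded_op Bs := bounded_op_adjoint Bb.
have DE := (bounded_opD Bb, bounded_opN Bb, bounded_opZ Bb,
  bounded_opD Bsb, bounded_opN Bsb, bounded_opZ Bsb).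
split; first by move=> z u; case: (has_grad_fd VV Psi B Xhat c dt B_cont z u).
(* A constant guess [ahat] covers both cases, with [ahat] = 0 in (i). *)
have ua ahat l z := irh_stepE VV Psi B Xhat c dt rho B_cont (fun=> ahat) l z.
split=> [u0 F alpha G|ahat Bahat u0 F alpha G].
  have ua0 l z : irh_step VV Psi B Vdes dt (fun=> rho) u0 l z = alpha z.1 z.2.
    by rewrite ua /alpha /F (bounded_op0 Bb) (bounded_op0 Bsb) scaler0 subr0 addr0.
  split=> [l|l|c2_small Vhat]; first exact: ua0.
    apply: irh_state_euler ua0 _ _ => X V; rewrite /G /T /alpha /F.
    by apply: innerI => h; rewrite !DE !innerE; ring.
  have hV := has_grad_shaped_potential B Xhat c2 c3 B_cont c2_gt0 c2_small.
  have TV := T_shaped_gradient B Xhat c2 c3 B_cont c2_gt0 c2_small.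
  split=> [X|X|]; first by case: (hV X).
    by rewrite (grad_eq _ _ _ (hV X)) [RHS]TV /F !DE.
  by apply: closed_loop_PH hV _ => // X V; rewrite TV.
have ua0 l z : irh_step VV Psi B Vdes dt (fun=> rho) u0 l z = alpha z.1 z.2.
  by rewrite ua Bahat.
split=> [l|l|c2_small Vhat]; first exact: ua0.
  apply: irh_state_euler ua0 _ _ => X V; rewrite /G /T /alpha /F.
  (* The summand [- ahat] of [F] contributes B ahat = g to the acceleration, which together with -c2
     B B* g is T g. *)
  move: (Psi X V + _) (grad VV Xhat) Bahat => w g Bg.
  by apply: innerI => h; rewrite !DE Bg !innerE; ring.
have hV X : has_grad (@inner R E) Vhat X
    (c3 *: Tmh (B (Bs (Tmh (X - Xhat)))) - grad VV Xhat).
  have := has_gradD _ _ _ _ _ _ (@innerDl _ _)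
    (has_grad_shaped_potential B Xhat c2 c3 B_cont c2_gt0 c2_small X)
    (has_grad_affine (- grad VV Xhat) Xhat X).
  by congr has_grad; apply/funext => Y; rewrite innerNl.
(* With g = [grad VV Xhat], T g = B ahat - c2 B B* g, so the linear term of [Vhat] accounts for the
   constant part of B F. *)
have TV X : T (c3 *: Tmh (B (Bs (Tmh (X - Xhat)))) - grad VV Xhat) =
    c3 *: B (Bs (X - Xhat)) - T (grad VV Xhat).
  rewrite -(T_shaped_gradient B Xhat c2 c3 B_cont c2_gt0 c2_small) /T.
  by apply: innerI => h; rewrite !DE !innerE; ring.
split=> [X|X|]; first by case: (hV X).
  rewrite (grad_eq _ _ _ (hV X)) [RHS]TV /F /T.
  move: (grad VV Xhat) Bahat => g Bg.
  by apply: innerI => h; rewrite !DE Bg !innerE; ring.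
(* The linear term of [Vhat] contributes T g, which merges with -T w into -T (w - g). *)
apply: closed_loop_PH hV _ => // X V; move: (TV X); rewrite /G /T => ->.
move: (Psi X V + _) (grad VV Xhat) => w g.
by apply: innerI => h; rewrite !DE !innerE; ring.
Qed.
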